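(* Let $F(z)=\sum_{n=0}^N a_n z^n\in\mathbb{C}[z]$ be a polynomial of degree $N\geq 1$ with complex coefficients, and let $L$ and $M$ be integers satisfying $0\leq L<M\leq N$ and $M-L>\max\{L,N-M\}$. Then $$\|F\|_\infty \geq |a_L|+|a_M|.$$ Further, if $1\leq p\leq 2$ then $$\|F\|_p \geq B_p\left(|a_L|^p+|a_M|^p\right)^{1/p},$$ and if $p\geq 1$ (with $p$ a real number) and $a_L$ and $a_M$ are not both $0$, then $$\|F\|_p \geq \max\{|a_L|,|a_M|\}\left(1+\left(\frac{p\min\{|a_L|,|a_M|\}}{2\max\{|a_L|,|a_M|\}}\right)^2\right)^{1/p}.$$
   Context: Write $e(t)=e^{2\pi i t}$. For a polynomial $f\in\mathbb{C}[z]$ and $0<p<\infty$, $\|f\|_p = \left(\int_0^1 |f(e(t))|^p\,dt\right)^{1/p}$, and $\|f\|_\infty=\sup\{|f(z)|: |z|\leq 1\}=\sup\{|f(e(t))|: t\in\mathbb{R}/\mathbb{Z}\}$. For a positive real number $p$, $$B_p = \left(\frac{1}{2}\int_0^1 |1-e(t)|^p\,dt\right)^{1/p} = \left(\frac{\Gamma(p+1)}{2\,\Gamma(p/2+1)^2}\right)^{1/p}.$$ *)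

(* Defs.v *)
From HB Require Import structures.
From mathcomp Require Export all_boot all_order all_algebra.
From mathcomp Require Export all_classical all_reals all_analysis.
From mathcomp Require Export complex.
Export Order.TTheory GRing.Theory Num.Theory.
Export numFieldNormedType.Exports.
Export ComplexField.Normc.

Set Implicit Arguments.
Unset Strict Implicit.
Unset Printing Implicit Defensive.

Local Open Scope classical_set_scope.
Local Open Scope ring_scope.

Definition circle_exp (R : realType) (t : R) : R[i] :=
  Complex (cos (2 * pi * t)) (sin (2 * pi * t)).

(* [normc : R[i] -> R] is the modulus as an element of R, whereas the generic
   norm `|z| of the library is valued in R[i] itself. *)
Definition poly_pnorm (R : realType) (p : R) (f : {poly R[i]}) : R :=
  (\int[@lebesgue_measure R]_(t in `[0, 1])
     (normc f.[circle_exp t] `^ p)) `^ p^-1.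

(* The set is nonempty and bounded above, so [sup] is a genuine supremum. *)
Definition poly_supnorm (R : realType) (f : {poly R[i]}) : R :=
  sup [set normc f.[z] | z in [set z : R[i] | normc z <= 1]].

Definition Bconst (R : realType) (p : R) : R :=
  (2^-1 * \int[@lebesgue_measure R]_(t in `[0, 1])
     (normc (1 - circle_exp t) `^ p)) `^ p^-1.

(* Main.v *)
(** With D = M - L, averaging F(zeta z) against zeta^-L over the D-th roots of
    unity zeta keeps only the coefficients of index L mod D, which the gap
    hypothesis reduces to L and M.  Hence |a_L z^L + a_M z^M| is at most the mean
    of the |F(zeta z)|, and by convexity every norm of F dominates that of
    |a_L| + |a_M| z.

    For p <= 2 write |a + b e|^2 = A + B cos with A = a^2 + b^2 and
    B = 2ab <= A.  It is a convex combination of A + A cos and A - A cos;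
    concavity of x^(p/2) and invariance of the mean under cos |-> - cos reduce
    to a = b, and concavity again gives (A/2)^(p/2) >= (a^p + b^p)/2.

    For the last bound let q = p/2.  Bessel's inequality for (1 + r z)^q would give
    at once that the mean of |1 + r z|^p is at least 1 + (q r)^2.  To stay within
    polynomials, replace (1 + r z)^q by (1 + (q/n) l_n)^n, where l_n is the n-th
    Taylor polynomial of log (1 + r z): its first two coefficients are 1 and q r,
    and |1 + w|^2 <= exp (2 Re w + |w|^2) bounds its modulus.  Convexity in r
    reaches r = 1. *)
Require Import Defs.
From mathcomp Require Import ring lra zify.
Set Implicit Arguments.
Unset Strict Implicit.
Unset Printing Implicit Defensive.
Local Open Scope classical_set_scope.
Local Open Scope ring_scope.

(** * Means over a period *)

Definition mean {R : realType} (f : R -> R) : R :=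
  \int[@lebesgue_measure R]_(t in `[0, 1]) f t.

Section Mean.
Context {R : realType}.
Implicit Types f g : R -> R.

Lemma continuous_integrable f a b : continuous f ->
  (@lebesgue_measure R).-integrable `[a, b] (EFin \o f).
Proof.
move=> cf; apply: continuous_compact_integrable; first exact: segment_compact.
exact: continuous_subspaceT.
Qed.

Lemma mean_ext f g : f =1 g -> mean f = mean g.
Proof. by move=> fg; apply: eq_Rintegral => x _. Qed.

Lemma meanD f g : continuous f -> continuous g ->
  mean (fun t => f t + g t) = mean f + mean g.
Proof. by move=> cf cg; rewrite /mean RintegralD//; exact: continuous_integrable. Qed.

Lemma meanZ f (c : R) : continuous f -> mean (fun t => c * f t) = c * mean f.
Proof. by move=> cf; rewrite /mean RintegralZl//; exact: continuous_integrable. Qed.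

Lemma mean_cst (c : R) : mean (fun=> c) = c.
Proof.
have := @lebesgue_measure_itv R `[0, 1]; rewrite /= lte_fin ltr01 => m1.
by rewrite /mean Rintegral_cst//= m1 -EFinB /= subr0 mulr1.
Qed.

Lemma le_mean f g : continuous f -> continuous g -> (forall t, f t <= g t) ->
  mean f <= mean g.
Proof. by move=> cf cg fg; apply: le_Rintegral => //; exact: continuous_integrable. Qed.

Lemma mean_ge0 f : (forall t, 0 <= f t) -> 0 <= mean f.
Proof. by move=> f0; apply: Rintegral_ge0. Qed.

Lemma mean_sum (n : nat) (f : 'I_n -> R -> R) : (forall i, continuous (f i)) ->
  mean (fun t => \sum_(i < n) f i t) = \sum_(i < n) mean (f i).
Proof.
elim: n f => [|n IH] f cf.
  rewrite big_ord0 (@mean_ext _ (fun=> 0)) ?mean_cst// => t.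
  by rewrite big_ord0.
have cs (m : nat) (h : 'I_m -> R -> R) : (forall i, continuous (h i)) ->
    continuous (fun t => \sum_(i < m) h i t).
  by move=> ch; apply: continuous_big => //; exact: add_continuous.
rewrite big_ord_recr /= -IH// -meanD//; last exact: cs.
by apply: mean_ext => t; rewrite big_ord_recr.
Qed.

(** The integral from [- K] is differentiable inside the window. A bounded window suffices, since
    only finitely many periods are visited at a time. *)
Lemma antiderivative f (K : R) : continuous f ->
  {G : R -> R | forall x, - K < x -> x < K -> is_derive x 1 G (f x)}.
Proof.
move=> cf; exists (fun x => \int[@lebesgue_measure R]_(t in `[- K, x]) f t).
move=> x Kx xK.
have [|||d1 d2] := @continuous_FTC1_closed R f (- K) x K xK.
- exact: continuous_integrable.
- exact: Kx.
- exact: cf.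
by apply: DeriveDef; [exact: d1|rewrite -derive1E; exact: d2].
Qed.

Lemma Rint_FTC f (G : R -> R) (a b : R) : a < b -> continuous f ->
  (forall x, a <= x <= b -> is_derive x 1 G (f x)) ->
  \int[@lebesgue_measure R]_(t in `[a, b]) f t = G b - G a.
Proof.
move=> ab cf dG.
have cG x : a <= x <= b -> {for x, continuous G}.
  move=> xab; apply: differentiable_continuous; apply/derivable1_diffP.
  by case: (dG x xab).
rewrite /Rintegral (@continuous_FTC2 _ f G a b) //.
- exact: continuous_subspaceT.
- split.
  + by move=> x /[!in_itv]/= /andP[ax xb]; have [] := dG x _; rewrite ?(ltW ax) ?(ltW xb).
  + apply: cvg_at_right_filter; apply: cG; lra.
  + apply: cvg_at_left_filter; apply: cG; lra.
- move=> x /[!in_itv]/= /andP[ax xb]; rewrite derive1E.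
  by case: (dG x) => [|_ ->]; rewrite ?(ltW ax) ?(ltW xb).
Qed.

(** Substitution: [k^-1 * G (k * t + s)] is a primitive of the integrand. Every [k * t + s] with t
    in [0, 1] has modulus at most |k| + |s|, so a primitive on that window is enough. *)
Lemma mean_affine f (G : R -> R) (k s : R) : k != 0 -> continuous f ->
  (forall x : R, `|x| <= `|k| + `|s| -> is_derive x 1 G (f x)) ->
  mean (fun t => f (k * t + s)) = (G (k + s) - G s) / k.
Proof.
move=> k0 cf dG; rewrite /mean.
have cfk : continuous (fun t => f (k * t + s)).
  move=> t; apply: continuous_comp; last exact: cf.
  apply: cvgD; last exact: cvg_cst.
  by apply: cvgM; [exact: cvg_cst|exact: cvg_id].
have dGk (x : R) : 0 <= x <= 1 ->
    is_derive x 1 (fun t => k^-1 * G (k * t + s)) (f (k * x + s)).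
  move=> x01.
  have dGx : is_derive (k * x + s) 1 G (f (k * x + s)).
    apply: dG; rewrite (le_trans (ler_normD _ _))// lerD2r normrM ler_piMr//.
    by rewrite ger0_norm; lra.
  have dlin : is_derive x 1 (fun t : R => k * t + s) k.
    have := is_deriveD (is_deriveZ k (is_derive_id x 1)) (is_derive_cst s x 1).
    by rewrite addr0 [_ *: _]mulr1.
  have := is_deriveZ k^-1 (@is_derive1_comp R G (fun t => k * t + s) x _ _ dGx dlin).
  by rewrite [_ *: _]mulrCA mulVf// mulr1.
rewrite (Rint_FTC ltr01 cfk dGk).
by rewrite mulr1 mulr0 add0r; field.
Qed.

(** Translations are treated first, by showing that the mean does not depend on the shift; a
    dilation then sweeps n+1 full periods, each with the same integral. *)
Lemma mean_periodic f (n : nat) (s : R) : continuous f ->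
  (forall t, f (t + 1) = f t) ->
  mean (fun t => f (n.+1%:R * t + s)) = mean f.
Proof.
move=> cf f1.
have fn t m : f (t + m%:R) = f t.
  by elim: m => [|m IH]; rewrite ?addr0// -natr1 addrA f1.
have shift (u : R) : mean (fun t => f (t + u)) = mean f.
  have [G dG] := @antiderivative f (`|u| + 4) cf.
  have e (v : R) : `|v| <= `|u| -> mean (fun t => f (t + v)) = G (1 + v) - G v.
    move=> vu; have dGv (x : R) : `|x| <= `|1 : R| + `|v| -> is_derive x 1 G (f x).
      rewrite normr1 => xv; have /ler_normlP[] : `|x| <= `|u| + 1 by lra.
      by move=> *; apply: dG; lra.
    rewrite -[RHS]divr1 -(mean_affine (oner_neq0 R) cf dGv).
    by apply: mean_ext => t; rewrite mul1r.
  pose H v := G (1 + v) - G v.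
  (* The derivative f(1 + v) - f(v) vanishes by periodicity, so [H] is constant. *)
  have dH (v : R) : `|v| <= `|u| -> is_derive v 1 H 0.
    move=> /ler_normlP[v1 v2].
    have dlin : is_derive v 1 (fun t : R => 1 + t) 1.
      by have := is_deriveD (is_derive_cst (1 : R) v 1) (is_derive_id v 1); rewrite add0r.
    have d1 : is_derive (1 + v) 1 G (f (1 + v)) by apply: dG; lra.
    have d2 : is_derive v 1 G (f v) by apply: dG; lra.
    have := is_deriveB (@is_derive1_comp R G (fun t => 1 + t) v _ _ d1 dlin) d2.
    by rewrite mulr1 (addrC 1 v) f1 subrr.
  have cH (v : R) : `|v| <= `|u| -> {for v, continuous H}.
    move=> vu; apply: differentiable_continuous; apply/derivable1_diffP.
    by case: (dH v vu).
  have eqH (a b : R) : `|a| <= `|u| -> `|b| <= `|u| -> a <= b -> H a = H b.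
    move=> au bu ab; apply/esym/eqP; rewrite -subr_eq0; apply/eqP.
    have small x : x \in `[a, b] -> `|x| <= `|u|.
      rewrite in_itv/= => /andP[ax xb]; move: au bu => /ler_normlP[? ?] /ler_normlP[? ?].
      by apply/ler_normlP; split; lra.
    have [||c _ ->] := @MVT_segment R H (fun=> 0) a b ab; last by rewrite mul0r.
      by move=> x xab; apply/dH/small/subset_itv_oo_cc.
    apply: continuous_in_subspaceT => x /[!inE] xab; apply/cH/small; exact: xab.
  rewrite e// (_ : mean f = mean (fun t => f (t + 0))).
    rewrite e ?normr0// -/(H u) -/(H 0).
    have [u0|u0] := leP 0 u; first by apply/esym/eqH; rewrite ?normr0.
    by apply: eqH; rewrite ?normr0// ltW.
  by apply: mean_ext => t; rewrite addr0.
have cshift (u : R) : continuous (fun t => f (t + u)).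
  move=> t; apply: continuous_comp; last exact: cf.
  by apply: cvgD; [exact: cvg_id|exact: cvg_cst].
rewrite -(shift s).
pose g t := f (t + s).
have [G dG] := @antiderivative g (n.+1%:R + 3) (cshift s).
have n0 : n.+1%:R != 0 :> R by [].
rewrite (@mean_ext _ (fun t => g (n.+1%:R * t + 0))); last by move=> t; rewrite addr0.
have dG0 (x : R) : `|x| <= `|n.+1%:R| + `|0 : R| -> is_derive x 1 G (g x).
  by rewrite normr0 addr0 normr_nat => /ler_normlP[x1 x2]; apply: dG; lra.
rewrite (mean_affine n0 (cshift s) dG0).
(* The integral over [0, n+1] is summed period by period; m stays bounded because [G] is a primitive
   only in its window. *)
suff step m : (m <= n.+1)%N -> G m%:R - G 0 = m%:R * mean g.
  by rewrite addr0 step// mulrAC mulfV// mul1r.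
elim: m => [_|m IH mn]; first by rewrite subrr mul0r.
have : mean g = (G (1 + m%:R) - G m%:R) / 1.
  have dGm (x : R) : `|x| <= `|1 : R| + `|m%:R : R| -> is_derive x 1 G (g x).
    rewrite normr1 normr_nat => xm.
    have : m%:R <= n%:R :> R by rewrite ler_nat.
    have : n.+1%:R = n%:R + 1 :> R by rewrite natr1.
    by move: xm => /ler_normlP[*]; apply: dG; lra.
  rewrite -(mean_affine (oner_neq0 R) (cshift s) dGm).
  by apply: mean_ext => t; rewrite /g mul1r addrAC fn.
rewrite divr1 nat1r => e; rewrite -natr1 mulrDl mul1r -IH 1?ltnW//.
by rewrite e natr1; ring.
Qed.
End Mean.

(** * The unit circle *)

Section Circle.
Context {R : realType}.
Implicit Types (s t x : R) (z w : R[i]).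

Lemma circle_expD s t : circle_exp (s + t) = circle_exp s * circle_exp t.
Proof.
rewrite /circle_exp mulrDr cosD sinD; simpc.
by congr (_ +i* _)%C; ring.
Qed.

Lemma circle_exp0 : circle_exp 0 = 1 :> R[i].
Proof. by rewrite /circle_exp mulr0 cos0 sin0. Qed.

Lemma circle_exp1 : circle_exp 1 = 1 :> R[i].
Proof. by rewrite /circle_exp mulr1 mulr_natl cos2pi sin2pi. Qed.

Lemma circle_exp_half : circle_exp 2^-1 = - 1 :> R[i].
Proof.
rewrite /circle_exp mulrAC mulfV// mul1r cospi sinpi.
by apply/eqP; rewrite eq_complex /= oppr0 !eqxx.
Qed.

Lemma circle_expDhalf t : circle_exp (t + 2^-1) = - circle_exp t.
Proof. by rewrite circle_expD circle_exp_half mulrN1. Qed.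

Lemma circle_exp_periodic t : circle_exp (t + 1) = circle_exp t.
Proof. by rewrite circle_expD circle_exp1 mulr1. Qed.

Lemma circle_expX t (n : nat) : circle_exp t ^+ n = circle_exp (n%:R * t).
Proof.
elim: n => [|n IH]; first by rewrite mul0r circle_exp0.
by rewrite exprSr IH -circle_expD -natr1 mulrDl mul1r.
Qed.

(** By the double angle formula, cos (2 pi t) = 1 would force sin (pi t) = 0, but sin is positive on
    (0, pi). *)
Lemma circle_exp_neq1 t : 0 < t -> t < 1 -> circle_exp t != 1.
Proof.
move=> t0 t1; apply/eqP => /(congr1 (@complex.Re R)) /= /eqP.
have -> : 2 * pi * t = (pi * t) *+ 2 by rewrite mulr2n; ring.
rewrite cos_mulr2n cos2sin2 => /eqP e.
have : 0 < sin (pi * t).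
  by apply: sin_gt0_pi; rewrite mulr_gt0 ?pi_gt0//= gtr_pMr ?pi_gt0.
by move=> /(exprn_gt0 2); rewrite mulr2n in e; lra.
Qed.

Lemma normc_sqrE z : normc z ^+ 2 = complex.Re z ^+ 2 + complex.Im z ^+ 2.
Proof. by case: z => a b /=; rewrite sqr_sqrtr// addr_ge0 ?sqr_ge0. Qed.

Lemma normc_ge0 z : 0 <= normc z.
Proof. by case: z => a b /=; rewrite sqrtr_ge0. Qed.

Lemma normc_circle t : normc (circle_exp t) = 1.
Proof. by rewrite /= cos2sin2 subrK sqrtr1. Qed.

Lemma normc_real x : normc (x%:C)%C = `|x|.
Proof. by rewrite /= expr0n addr0 sqrtr_sqr. Qed.

Lemma normcX z (n : nat) : normc (z ^+ n) = normc z ^+ n.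
Proof. by elim: n => [|n IH]; rewrite ?normc1// !exprS normcM IH. Qed.

Lemma normc_sum (n : nat) (f : 'I_n -> R[i]) :
  normc (\sum_(i < n) f i) <= \sum_(i < n) normc (f i).
Proof.
elim: n f => [|n IH] f; first by rewrite !big_ord0 normc0.
by rewrite !big_ord_recr/= (le_trans (le_normcD _ _))// lerD2r.
Qed.

Lemma polar z : exists t, z = (normc z)%:C%C * circle_exp t.
Proof.
have [z0|z0] := eqVneq (normc z) 0.
  by exists 0; rewrite z0 mul0r; exact: eq0_normc.
have n0 : 0 < normc z by rewrite lt0r z0 normc_ge0.
case: z z0 n0 => a b; set r := normc _ => r0 r_gt0.
have r2 : r ^+ 2 = a ^+ 2 + b ^+ 2 by rewrite normc_sqrE.
pose c := a / r.
have c2 : 1 - c ^+ 2 = (b / r) ^+ 2.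
  by rewrite !expr_div_n r2; field; rewrite -r2 expf_neq0.
have c1 : -1 <= c <= 1.
  rewrite -ler_norml -(@ler_pXn2r _ 2)// ?nnegrE// expr1n real_normK ?num_real//.
  by rewrite -subr_ge0 c2 sqr_ge0.
(* The cosine fixes the argument up to sign; the sign of the imaginary part decides. *)
pose u : R := if 0 <= b then acos c else - acos c.
exists (u / (2 * pi)).
have pi0 : pi != 0 :> R by rewrite gt_eqF ?pi_gt0.
rewrite /circle_exp (_ : 2 * pi * (u / (2 * pi)) = u); last first.
  by rewrite mulrC divfK// mulf_neq0.
have cu : cos u = c by rewrite /u; case: ifP => _; rewrite ?cosN acosK.
have su : sin u = b / r.
  rewrite /u; case: ifPn => b0; rewrite ?sinN sin_acos// c2 sqrtr_sqr.
    by rewrite ger0_norm// divr_ge0// ltW.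
  by rewrite ltr0_norm ?opprK// ltr_pdivrMr// mul0r ltNge.
by rewrite cu su; simpc; congr (_ +i* _)%C; rewrite mulrC divfK.
Qed.

(** * Continuity through real and imaginary parts *)

Definition ccontinuous (f : R -> R[i]) :=
  continuous (fun t => complex.Re (f t)) /\ continuous (fun t => complex.Im (f t)).

Lemma ccontinuous_cst z : ccontinuous (fun=> z).
Proof. by split => t; exact: cvg_cst. Qed.

Lemma ccontinuousD (f g : R -> R[i]) : ccontinuous f -> ccontinuous g ->
  ccontinuous (fun t => f t + g t).
Proof.
move=> [f1 f2] [g1 g2]; split.
  rewrite (_ : (fun t => _) = (fun t => complex.Re (f t) + complex.Re (g t))).
    by move=> t; apply: cvgD; [exact: f1|exact: g1].
  by apply/funext => t; rewrite raddfD.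
rewrite (_ : (fun t => _) = (fun t => complex.Im (f t) + complex.Im (g t))).
  by move=> t; apply: cvgD; [exact: f2|exact: g2].
by apply/funext => t; rewrite raddfD.
Qed.

Lemma ccontinuousM (f g : R -> R[i]) : ccontinuous f -> ccontinuous g ->
  ccontinuous (fun t => f t * g t).
Proof.
move=> [f1 f2] [g1 g2]; split.
  rewrite (_ : (fun t => _) = (fun t => complex.Re (f t) * complex.Re (g t) -
                                        complex.Im (f t) * complex.Im (g t))).
    by move=> t; apply: cvgB; apply: cvgM; by [exact: f1|exact: g1|exact: f2|exact: g2].
  by apply/funext => t; case: (f t) (g t) => [a b] [c d].
rewrite (_ : (fun t => _) = (fun t => complex.Re (f t) * complex.Im (g t) +
                                      complex.Im (f t) * complex.Re (g t))).
  by move=> t; apply: cvgD; apply: cvgM; by [exact: f1|exact: g1|exact: f2|exact: g2].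
by apply/funext => t; case: (f t) (g t) => [a b] [c d].
Qed.

Lemma ccontinuous_circle (k : R) : ccontinuous (fun t => circle_exp (k * t)).
Proof.
have ck : continuous (fun t => 2 * pi * (k * t)).
  by move=> t; apply: cvgM; [exact: cvg_cst|apply: cvgM; [exact: cvg_cst|exact: cvg_id]].
by split => t; apply: (continuous_comp (ck t)); [exact: continuous_cos|exact: continuous_sin].
Qed.

Lemma ccontinuous_horner (F : {poly R[i]}) (f : R -> R[i]) : ccontinuous f ->
  ccontinuous (fun t => F.[f t]).
Proof.
move=> cf; elim/poly_ind: F => [|F c IH].
  rewrite (_ : (fun t => _) = (fun=> 0)); first exact: ccontinuous_cst.
  by apply/funext => t; rewrite horner0.
rewrite (_ : (fun t => _) = (fun t => F.[f t] * f t + c)); last first.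
  by apply/funext => t; rewrite hornerMXaddC.
by apply: ccontinuousD (ccontinuous_cst _); exact: ccontinuousM.
Qed.

Lemma ccontinuous_normc (f : R -> R[i]) : ccontinuous f ->
  continuous (fun t => normc (f t)).
Proof.
move=> [f1 f2].
have -> : (fun t => normc (f t)) = (fun t =>
    Num.sqrt (complex.Re (f t) * complex.Re (f t) + complex.Im (f t) * complex.Im (f t))).
  by apply/funext => t; case: (f t).
move=> t; apply: (@continuous_comp _ _ _ (fun t => _ + _)); last exact: sqrt_continuous.
by apply: cvgD; apply: cvgM; by [exact: f1|exact: f2].
Qed.

(** Where f is positive the power is differentiable. At a zero of f it may fail to be, and
    continuity is checked directly with delta = e^(1/p). *)
Lemma continuous_powR (f : R -> R) (p : R) : 0 < p -> (forall t, 0 <= f t) ->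
  continuous f -> continuous (fun t => f t `^ p).
Proof.
move=> p0 f0 cf t; have := f0 t; rewrite le_eqVlt => /predU1P[ft|ft]; last first.
  apply: (@continuous_comp _ _ _ f (fun x => x `^ p)); first exact: cf.
  apply: differentiable_continuous; apply/derivable1_diffP.
  by have [] := @is_derive1_powR R p (f t) ft.
rewrite /continuous_at -ft powR0 ?gt_eqF//.
apply/cvgrPdist_le => e e0.
have d0 : 0 < e `^ p^-1 by rewrite powR_gt0.
have := cf t; rewrite /continuous_at -ft => /cvgrPdist_le /(_ _ d0).
apply: filterS => x; rewrite !sub0r !normrN !ger0_norm ?powR_ge0// => xd.
have -> : e = (e `^ p^-1) `^ p by rewrite -powRrM mulVf ?gt_eqF// powRr1// ltW.
by apply: ge0_ler_powR; rewrite ?nnegrE ?powR_ge0// ltW.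
Qed.

Lemma continuous_normc_powR (f : R -> R[i]) (p : R) : 0 < p -> ccontinuous f ->
  continuous (fun t => normc (f t) `^ p).
Proof.
move=> p0 cf; apply: continuous_powR => // [t|]; first exact: normc_ge0.
exact: ccontinuous_normc.
Qed.

End Circle.

(** * Filtering by roots of unity *)

Section Filter.
Context {R : realType}.
Implicit Types (p t x : R) (z w : R[i]).

(** If D does not divide j, then zeta^j differs from 1, and multiplying the geometric sum by zeta^j
    - 1 gives zeta^(jD) - 1 = 0. *)
Lemma sum_circle_exp (D j : nat) : (0 < D)%N ->
  \sum_(k < D) circle_exp (D%:R^-1 : R) ^+ (k * j) =
    if (D %| j)%N then D%:R else 0.
Proof.
move=> D0; set zeta := circle_exp _.
have zD : zeta ^+ D = 1.
  by rewrite circle_expX mulfV ?circle_exp1// pnatr_eq0 -lt0n.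
have [/dvdnP[m ->]|Dj] := ifPn.
  rewrite (eq_bigr (fun=> 1)) ?sumr_const ?card_ord// => k _.
  by rewrite mulnA mulnC exprM zD expr1n.
have z1 : zeta ^+ j != 1.
  have -> : zeta ^+ j = zeta ^+ (j %% D).
    by rewrite {1}(divn_eq j D) exprD (mulnC _ D) exprM zD expr1n mul1r.
  have D0' : 0 < D%:R :> R by rewrite ltr0n.
  rewrite circle_expX; apply: circle_exp_neq1; first by rewrite divr_gt0// ltr0n lt0n.
  by rewrite ltr_pdivrMr// mul1r ltr_nat ltn_mod.
apply: (mulfI (_ : zeta ^+ j - 1 != 0)); first by rewrite subr_eq0.
rewrite mulr0 (eq_bigr (fun k : 'I_D => (zeta ^+ j) ^+ k)); last first.
  by move=> k _; rewrite mulnC exprM.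
by rewrite -subrX1 -exprM mulnC exprM zD expr1n subrr.
Qed.

(** With D = M - L, the exponent k(D - L) replaces -kL so as to stay natural. The index i survives
    exactly when D divides D - L + i. *)
Lemma root_of_unity_filter (F : {poly R[i]}) (N L M : nat) z :
  (size F <= N.+1)%N -> (L < M)%N -> (M <= N)%N -> (maxn L (N - M) < M - L)%N ->
  \sum_(k < M - L) circle_exp ((M - L)%:R^-1 : R) ^+ (k * (M - L - L)) *
     F.[circle_exp (k%:R / (M - L)%:R) * z] =
  (M - L)%:R * (F`_L * z ^+ L + F`_M * z ^+ M).
Proof.
move=> sF LM MN; rewrite gtn_max => /andP[LD NMD].
set D := (M - L)%N; have D0 : (0 < D)%N by rewrite subn_gt0.
set zeta := circle_exp _.
have -> : \sum_(k < D) zeta ^+ (k * (D - L)) * F.[circle_exp (k%:R / D%:R) * z] =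
  \sum_(k < D) \sum_(i < N.+1) F`_i * z ^+ i * zeta ^+ (k * (D - L + i)).
  apply: eq_bigr => k _; rewrite (horner_coef_wide _ sF) mulr_sumr.
  apply: eq_bigr => i _; rewrite -circle_expX -/zeta exprMn -exprM.
  by rewrite mulnDr exprD; ring.
rewrite exchange_big /=.
under eq_bigr => i _ do rewrite -mulr_sumr sum_circle_exp//.
have LN : (L < N.+1)%N by lia.
have MN1 : (M < N.+1)%N by lia.
rewrite (bigD1 (Ordinal LN))//= (bigD1 (Ordinal MN1))/=; last first.
  by rewrite -val_eqE /= gtn_eqF.
rewrite subnK ?(ltnW LD)// dvdnn.
have -> : (D - L + M = 2 * D)%N by rewrite /D; lia.
rewrite dvdn_mull// big1 ?addr0; last first.
  move=> [i iN] /=; rewrite -!val_eqE/= => /andP[iL iM].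
  rewrite ifF ?mulr0//; apply/negP => /dvdnP[q].
  (* Quotient 0 contradicts L < D, quotients 1 and 2 give i = L and i = M, and from 3 on i >= M + D
     > N. *)
  case: q => [|[|[|q]]]; rewrite /D in LD *; nia.
by rewrite -mulrDl mulrC.
Qed.

Lemma filter_normc_le (F : {poly R[i]}) (N L M : nat) z :
  (size F <= N.+1)%N -> (L < M)%N -> (M <= N)%N -> (maxn L (N - M) < M - L)%N ->
  (M - L)%:R * normc (F`_L * z ^+ L + F`_M * z ^+ M) <=
  \sum_(k < M - L) normc F.[circle_exp (k%:R / (M - L)%:R) * z].
Proof.
move=> sF LM MN gap.
have normcn (n : nat) : normc (n%:R : R[i]) = n%:R.
  by rewrite -(rmorph_nat (real_complex R)) normc_real ger0_norm.
rewrite -[X in X * _]normcn -normcM -(root_of_unity_filter z sF LM MN gap).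
apply: le_trans (normc_sum _) _; apply: ler_sum => k _.
by rewrite normcM normcX normc_circle expr1n mul1r.
Qed.

(** The sum of the moduli of the coefficients bounds the values on the disc, so the supremum is a
    true upper bound. *)
Lemma le_poly_supnorm (F : {poly R[i]}) z : normc z <= 1 ->
  normc F.[z] <= poly_supnorm F.
Proof.
move=> z1; apply: ub_le_sup; last by exists z.
exists (\sum_(i < size F) normc F`_i) => _ [w /= w1 <-].
rewrite horner_coef (le_trans (normc_sum _))// ler_sum// => i _.
by rewrite normcM ler_piMr ?normc_ge0// normcX exprn_ile1// normc_ge0.
Qed.

(** * Convexity and concavity of powers *)

Lemma convex_powR2 p x y l : 1 <= p -> 0 <= x -> 0 <= y -> 0 <= l <= 1 ->
  (l * x + (1 - l) * y) `^ p <= l * x `^ p + (1 - l) * y `^ p.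
Proof.
move=> p1 x0 y0 /andP[l0 l1].
have := @convex_powR R p p1 (Itv01 l0 l1) x y.
by rewrite !inE/= !in_itv/= !andbT => /(_ x0 y0); rewrite !convRE.
Qed.

(** Convexity of the inverse function u^(1/p), applied at x^p and y^p, and then raised to the power
    p. *)
Lemma concave_powR2 p x y l : 0 < p -> p <= 1 -> 0 <= x -> 0 <= y -> 0 <= l <= 1 ->
  l * x `^ p + (1 - l) * y `^ p <= (l * x + (1 - l) * y) `^ p.
Proof.
move=> p0 p1 x0 y0 l01; have /andP[l0 l1] := l01.
have ip1 : 1 <= p^-1 by rewrite invf_ge1.
have e u : 0 <= u -> (u `^ p) `^ p^-1 = u.
  by move=> u0; rewrite -powRrM mulfV ?gt_eqF// powRr1.
have := convex_powR2 ip1 (powR_ge0 x p) (powR_ge0 y p) l01.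
rewrite !e// => h.
set u := l * x `^ p + _ in h *.
have u0 : 0 <= u by rewrite addr_ge0// mulr_ge0 ?powR_ge0// subr_ge0.
have -> : u = (u `^ p^-1) `^ p by rewrite -powRrM mulVf ?gt_eqF// powRr1.
apply: ge0_ler_powR => //; rewrite ?nnegrE ?powR_ge0 ?(ltW p0)//.
by rewrite addr_ge0// mulr_ge0// subr_ge0.
Qed.

(** Jensen by induction: the mean of n+2 terms combines the mean of the first n+1, with weight
    (n+1)/(n+2), and the last term. *)
Lemma powR_mean_le (n : nat) p (f : 'I_n.+1 -> R) : 1 <= p -> (forall i, 0 <= f i) ->
  (n.+1%:R^-1 * \sum_(i < n.+1) f i) `^ p <= n.+1%:R^-1 * \sum_(i < n.+1) f i `^ p.
Proof.
move=> p1; elim: n f => [|n IH] f f0.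
  by rewrite !big_ord_recl !big_ord0 invr1 !addr0 !mul1r.
rewrite !(big_ord_recr n.+1)/=.
have n1 : 0 < n.+1%:R :> R by rewrite ltr0n.
have n2 : n.+2%:R = n.+1%:R + 1 :> R by rewrite natr1.
have n20 : 0 < n.+2%:R :> R by rewrite ltr0n.
pose l : R := n.+1%:R / n.+2%:R.
have l01 : 0 <= l <= 1.
  by rewrite /l divr_ge0 ?(ltW n1) ?(ltW n20)//= ler_pdivrMr// mul1r n2 lerDl.
have l1 : 1 - l = n.+2%:R^-1 
    by rewrite /l -[X in X - _](mulfV (lt0r_neq0 n20)) -mulrBl n2 addrC addKr mul1r.
have e (S u : R) : n.+2%:R^-1 * (S + u) = l * (n.+1%:R^-1 * S) + (1 - l) * u.
  rewrite l1 mulrDr /l; congr (_ + _); rewrite mulrA (mulrAC n.+1%:R) mulfV ?mul1r//.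
rewrite !e; apply: le_trans (convex_powR2 p1 _ (f0 _) l01) _.
  by apply: mulr_ge0; [rewrite invr_ge0 ltW|exact: sumr_ge0].
by rewrite lerD2r ler_wpM2l ?(andP l01).1//; exact: IH.
Qed.

(** Factoring out the phase of a and the unimodular e(Lt) leaves only s, the difference of the two
    arguments. *)
Lemma normc_binomial_rotate (a b : R[i]) : exists s, forall (L D : nat) t,
  normc (a * circle_exp t ^+ L + b * circle_exp t ^+ (L + D)) =
  normc ((normc a)%:C%C + (normc b)%:C%C * circle_exp (D%:R * t + s)).
Proof.
have [s es] := polar a; have [u eu] := polar b.
exists (u - s) => L D t.
rewrite {1}es {1}eu exprD -!mulrA (mulrCA (circle_exp u)).
rewrite (_ : circle_exp u = circle_exp (u - s) * circle_exp s); last first.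
  by rewrite -circle_expD subrK.
rewrite circle_expX (circle_expX t D) (circle_expD (D%:R * t)).
set P := circle_exp _; set Q := circle_exp (L%:R * t); set S := circle_exp (u - s).
set T := circle_exp (D%:R * t).
rewrite (_ : _ + _ = (P * Q) * ((normc a)%:C%C + (normc b)%:C%C * (T * S))); last by ring.
by rewrite !normcM !normc_circle !mul1r.
Qed.

Lemma supnorm_lower_bound (F : {poly R[i]}) (N L M : nat) :
  (size F <= N.+1)%N -> (L < M)%N -> (M <= N)%N -> (maxn L (N - M) < M - L)%N ->
  normc F`_L + normc F`_M <= poly_supnorm F.
Proof.
move=> sF LM MN gap; have [s es] := normc_binomial_rotate F`_L F`_M.
have D0 : 0 < (M - L)%:R :> R by rewrite ltr0n subn_gt0.
(* This t makes the remaining phase (M - L) t + s vanish, so the two terms are aligned and their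
   moduli add up. *)
pose t : R := - s / (M - L)%:R.
have := filter_normc_le (circle_exp t) sF LM MN gap.
have -> : normc (F`_L * circle_exp t ^+ L + F`_M * circle_exp t ^+ M) =
    normc F`_L + normc F`_M.
  have := es L (M - L)%N t; rewrite subnKC ?(ltnW LM)// => ->.
  rewrite [X in circle_exp (X + _)]mulrC divfK ?gt_eqF// addNr circle_exp0 mulr1.
  by rewrite -rmorphD normc_real ger0_norm// addr_ge0 ?normc_ge0.
move=> h; rewrite -(ler_pM2l D0); apply: le_trans h _.
rewrite mulr_natl (_ : poly_supnorm F *+ _ = \sum_(k < M - L) poly_supnorm F); last first.
  by rewrite sumr_const card_ord.
apply: ler_sum => k _.
by apply: le_poly_supnorm; rewrite normcM !normc_circle mulr1.
Qed.

(** The p-th power of the p-norm of a + b z; both bounds for finite p reduce to it. *)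
Definition binomial_mean p (a b : R) :=
  mean (fun t => normc (a%:C%C + b%:C%C * circle_exp t) `^ p).

Lemma ccontinuous_binomial (a b k s : R) :
  ccontinuous (fun t => a%:C%C + b%:C%C * circle_exp (k * t + s)).
Proof.
apply: ccontinuousD (ccontinuous_cst _) _; apply: ccontinuousM (ccontinuous_cst _) _.
have -> : (fun t => circle_exp (k * t + s)) = fun t => circle_exp (k * t) * circle_exp s.
  by apply/funext => t; rewrite circle_expD.
exact: ccontinuousM (ccontinuous_circle _) (ccontinuous_cst _).
Qed.

(** Replacing t by Dt + s on the left, and averaging over the D translates by k/D on the right,
    changes neither mean. The inequality then holds pointwise, by the root of unity filter and
    Jensen. *)
Lemma binomial_mean_le (F : {poly R[i]}) (N L M : nat) p : 1 <= p ->
  (size F <= N.+1)%N -> (L < M)%N -> (M <= N)%N -> (maxn L (N - M) < M - L)%N ->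
  binomial_mean p (normc F`_L) (normc F`_M) <=
  mean (fun t => normc F.[circle_exp t] `^ p).
Proof.
move=> p1 sF LM MN gap; have [s es] := normc_binomial_rotate F`_L F`_M.
have p0 : 0 < p by rewrite (lt_le_trans ltr01).
have [n Dn] : exists n, (M - L = n.+1)%N by exists (M - L).-1; rewrite prednK ?subn_gt0.
set D := (M - L)%N in Dn.
have ccirc : ccontinuous (@circle_exp R).
  have -> : @circle_exp R = fun t => circle_exp (1 * t).
    by apply/funext => t; rewrite mul1r.
  exact: ccontinuous_circle.
pose g t := normc ((normc F`_L)%:C%C + (normc F`_M)%:C%C * circle_exp t) `^ p.
have cg : continuous g.
  apply: continuous_normc_powR => //.
  apply: ccontinuousD (ccontinuous_cst _) _.
  exact: ccontinuousM (ccontinuous_cst _) _.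
have g1 t : g (t + 1) = g t by rewrite /g circle_exp_periodic.
pose f t := normc F.[circle_exp t] `^ p.
have cf : continuous f.
  by apply: continuous_normc_powR => //; exact: ccontinuous_horner.
have f1 t : f (t + 1) = f t by rewrite /f circle_exp_periodic.
have cfk u : continuous (fun t => f (1%:R * t + u)).
  move=> t; apply: (@continuous_comp _ _ _ (fun t => 1%:R * t + u)); last exact: cf.
  apply: cvgD; last exact: cvg_cst.
  by apply: cvgM; [exact: cvg_cst|exact: cvg_id].
have cgk u : continuous (fun t => g (n.+1%:R * t + u)).
  move=> t; apply: (@continuous_comp _ _ _ (fun t => n.+1%:R * t + u)); last exact: cg.
  apply: cvgD; last exact: cvg_cst.
  by apply: cvgM; [exact: cvg_cst|exact: cvg_id].
rewrite /binomial_mean -/g -(mean_periodic n s cg g1).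
have -> : mean f = mean (fun t => n.+1%:R^-1 * \sum_(k < n.+1) f (1%:R * t + k%:R / n.+1%:R)).
  rewrite meanZ; last by apply: continuous_big => [|k _]; [exact: add_continuous|exact: cfk].
  rewrite mean_sum; last by move=> k; exact: cfk.
  rewrite (eq_bigr (fun=> mean f)); last by move=> k _; exact: mean_periodic.
  by rewrite sumr_const card_ord -(mulr_natl (mean f)) mulrA mulVf// mul1r.
apply: le_mean; first exact: cgk.
  move=> t; apply: cvgM; first exact: cvg_cst.
  by apply: continuous_big => [|k _]; [exact: add_continuous|exact: cfk].
move=> t; have := es L D t; rewrite subnKC ?(ltnW LM)// Dn /g => <-.
have := filter_normc_le (circle_exp t) sF LM MN gap; rewrite -/D Dn => h.
pose u (k : 'I_n.+1) := normc F.[circle_exp (1%:R * t + k%:R / n.+1%:R)].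
apply: le_trans (_ : (n.+1%:R^-1 * \sum_(k < n.+1) u k) `^ p <= _).
  have uE : \sum_(k < n.+1) u k =
      \sum_(k < n.+1) normc F.[circle_exp (k%:R / n.+1%:R) * circle_exp t].
    by apply: eq_bigr => k _; rewrite /u mul1r addrC circle_expD.
  apply: ge0_ler_powR; rewrite ?nnegrE ?normc_ge0 ?(ltW p0)//.
    by rewrite mulr_ge0 ?invr_ge0// sumr_ge0// => k _; exact: normc_ge0.
  by rewrite ler_pdivlMl ?ltr0n// uE.
by apply: powR_mean_le => // k; exact: normc_ge0.
Qed.
End Filter.

(** * The case p <= 2 *)

Section Binomial.
Context {R : realType}.
Implicit Types (p q t x r a b : R) (z w : R[i]).

Lemma sqr_normc_binomial a b t :
  normc (a%:C%C + b%:C%C * circle_exp t) ^+ 2 =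
  a ^+ 2 + b ^+ 2 + 2 * a * b * cos (2 * pi * t).
Proof.
rewrite normc_sqrE /= !mul0r subr0 addr0 add0r [in LHS]exprMn sin2cos2; ring.
Qed.

Lemma powR_normc z p : normc z `^ p = (normc z ^+ 2) `^ (p / 2).
Proof.
by rewrite -powR_mulrn ?normc_ge0// -powRrM mulrCA mulfV// mulr1.
Qed.

Lemma continuous_binomial_powR p a b : 0 < p ->
  continuous (fun t => normc (a%:C%C + b%:C%C * circle_exp t) `^ p).
Proof.
move=> p0; apply: continuous_normc_powR => //.
have -> : (fun t => a%:C%C + b%:C%C * circle_exp t) =
    fun t => a%:C%C + b%:C%C * circle_exp (1 * t + 0).
  by apply/funext => t; rewrite mul1r addr0.
exact: ccontinuous_binomial.
Qed.

Lemma binomial_meanC p a b : binomial_mean p a b = binomial_mean p b a.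
Proof.
apply: mean_ext => t; rewrite !powR_normc !sqr_normc_binomial.
by congr (_ `^ _); ring.
Qed.

(** A shift by half a period changes the sign of e(t). *)
Lemma binomial_meanN p a b : 0 < p -> binomial_mean p a (- b) = binomial_mean p a b.
Proof.
move=> p0; rewrite /binomial_mean.
pose g t := normc (a%:C%C + b%:C%C * circle_exp t) `^ p.
have g1 t : g (t + 1) = g t by rewrite /g circle_exp_periodic.
rewrite -/g -(mean_periodic 0 2^-1 (@continuous_binomial_powR p a b p0) g1).
apply: mean_ext => t; rewrite /g mul1r circle_expDhalf; congr (normc _ `^ _).
by rewrite rmorphN mulrN mulNr.
Qed.

Lemma binomial_meanZ p k a b : 0 < p -> 0 <= k ->
  binomial_mean p (k * a) (k * b) = k `^ p * binomial_mean p a b.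
Proof.
move=> p0 k0; rewrite /binomial_mean -meanZ; last exact: continuous_binomial_powR.
apply: mean_ext => t; rewrite !rmorphM -mulrA -mulrDr normcM normc_real ger0_norm//.
by rewrite powRM// normc_ge0.
Qed.

Lemma binomial_mean_lower p a b : 0 < p -> p <= 2 -> 0 <= a -> 0 <= b ->
  2^-1 * binomial_mean p 1 (-1) * (a `^ p + b `^ p) <= binomial_mean p a b.
Proof.
move=> p0 p2 a0 b0; set A := a ^+ 2 + b ^+ 2; set q := p / 2.
have q0 : 0 < q by rewrite divr_gt0.
have q1 : q <= 1 by rewrite ler_pdivrMr// mul1r.
have A0 : 0 <= A by rewrite addr_ge0 ?sqr_ge0.
have Bge0 u v : 0 <= binomial_mean p u v by apply: mean_ge0 => t; exact: powR_ge0.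
have [Az|An0] := eqVneq A 0.
  move/eqP: Az; rewrite paddr_eq0 ?sqr_ge0// !sqrf_eq0 => /andP[/eqP-> /eqP->].
  by rewrite powR0 ?gt_eqF// addr0 mulr0.
have Ap : 0 < A by rewrite lt0r An0.
have BA : 2 * a * b <= A by have := sqr_ge0 (a - b); rewrite /A; nra.
(* Chosen so that 2l - 1 = 2ab/A, that is, A + 2ab cos = l (A + A cos) + (1 - l)(A - A cos). *)
pose l := (1 + 2 * a * b / A) / 2.
have AB0 : 0 <= 2 * a * b / A by rewrite divr_ge0// !mulr_ge0.
have AB1 : 2 * a * b / A <= 1 by rewrite ler_pdivrMr// mul1r.
have l01 : 0 <= l <= 1 by rewrite /l; apply/andP; split; lra.
have sq u : 0 <= u -> u `^ p = (u ^+ 2) `^ q.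
  by move=> u0; rewrite -powR_mulrn// -powRrM /q mulrCA mulfV// mulr1.
(* Concavity of x^q at a^2 and b^2, with equal weights. *)
have hA : 2^-1 * (a `^ p + b `^ p) <= (A / 2) `^ q.
  have half : 0 <= (2^-1 : R) <= 1 by apply/andP; split; lra.
  have := concave_powR2 q0 q1 (sqr_ge0 a) (sqr_ge0 b) half.
  rewrite (_ : 1 - 2^-1 = 2^-1); last by lra.
  by rewrite -!mulrDr -!sq// (mulrC A).
have pw t : l * ((A / 2) `^ q * normc (1%:C%C + 1%:C%C * circle_exp t) `^ p) +
    (1 - l) * ((A / 2) `^ q * normc (1%:C%C + (-1)%:C%C * circle_exp t) `^ p) <=
    normc (a%:C%C + b%:C%C * circle_exp t) `^ p.
  rewrite !powR_normc -/q !sqr_normc_binomial -/A.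
  set c := cos _.
  have c1 : -1 <= c by exact: cos_geN1.
  have c2 : c <= 1 by exact: cos_le1.
  have A2 : 0 <= A / 2 by rewrite divr_ge0.
  have u0 : 0 <= 1 ^+ 2 + 1 ^+ 2 + 2 * 1 * 1 * c by lra.
  have v0 : 0 <= 1 ^+ 2 + (-1) ^+ 2 + 2 * 1 * (-1) * c by lra.
  rewrite -!powRM//.
  apply: le_trans (concave_powR2 q0 q1 _ _ l01) _; rewrite ?mulr_ge0//.
  rewrite le_eqVlt; apply/orP; left; apply/eqP; congr (_ `^ _).
  by rewrite /l; field.
have c1 := @continuous_binomial_powR p 1 1 p0.
have c2 := @continuous_binomial_powR p 1 (-1) p0.
have cZ (f : R -> R) k : continuous f -> continuous (fun t => k * f t).
  by move=> cf t; apply: cvgM; [exact: cvg_cst|exact: cf].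
have h1 := cZ _ l (cZ _ ((A / 2) `^ q) c1).
have h2 := cZ _ (1 - l) (cZ _ ((A / 2) `^ q) c2).
have : mean (fun t => l * ((A / 2) `^ q * normc (1%:C%C + 1%:C%C * circle_exp t) `^ p) +
    (1 - l) * ((A / 2) `^ q * normc (1%:C%C + (-1)%:C%C * circle_exp t) `^ p)) <=
    binomial_mean p a b.
  apply: le_mean pw; last exact: continuous_binomial_powR.
  by move=> t; apply: cvgD; [exact: h1|exact: h2].
rewrite meanD; [|exact: h1|exact: h2].
rewrite (meanZ _ (cZ _ _ c1)) (meanZ _ (cZ _ _ c2)) (meanZ _ c1) (meanZ _ c2).
(* Both means agree by the half-period shift, so the weights l and 1 - l add up to 1. *)
rewrite -/(binomial_mean p 1 1) -/(binomial_mean p 1 (-1)) -(@binomial_meanN p 1 1 p0).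
rewrite -mulrDl addrC subrK mul1r; apply: le_trans.
by rewrite mulrAC ler_wpM2r.
Qed.

End Binomial.

(** * Bessel's inequality *)

Section Bessel.
Context {R : realType}.
Implicit Types (p q t x r a b : R) (z w : R[i]).

Lemma ccontinuous_horner_circle (Q : {poly R[i]}) :
  ccontinuous (fun t : R => Q.[circle_exp t]).
Proof.
apply: ccontinuous_horner; have := @ccontinuous_circle R 1.
by under eq_fun do rewrite mul1r.
Qed.

(** Only positive frequencies occur, and each has mean zero. The induction keeps k general because a
    factor X raises the frequency by one. *)
Lemma mean_Re_circle_horner (Q : {poly R[i]}) (k : nat) :
  mean (fun t => complex.Re (circle_exp (k.+1%:R * t) * Q.[circle_exp t])) = 0.
Proof.
elim/poly_ind: Q k => [|Q c IH] k.
  by rewrite -[RHS](@mean_cst R 0); apply: mean_ext => t; rewrite horner0 mulr0.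
pose g t := complex.Re (c * circle_exp t).
have cc1 : ccontinuous (fun t : R => c * circle_exp t).
  apply: ccontinuousM (ccontinuous_cst _) _.
  by have := ccontinuous_horner_circle 'X; under eq_fun do rewrite hornerX.
have cg : continuous g by case: cc1.
have g1 t : g (t + 1) = g t by rewrite /g circle_exp_periodic.
(* The half-period shift turns g into -g. *)
have mg0 : mean g = 0.
  have : mean g = - mean g.
    rewrite -{1}(mean_periodic 0 2^-1 cg g1) -[RHS]mulN1r -meanZ//.
    by apply: mean_ext => t; rewrite /g mul1r circle_expDhalf mulrN raddfN mulN1r.
  by move=> h; lra.
rewrite (@mean_ext _ _ (fun t => complex.Re (circle_exp (k.+2%:R * t) * Q.[circle_exp t])
    + g (k.+1%:R * t + 0))); last first.
  move=> t; rewrite /g -raddfD hornerMXaddC addr0.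
  rewrite -[k.+2%:R]natr1 mulrDl mul1r circle_expD; congr complex.Re; ring.
rewrite meanD ?IH ?mean_periodic ?mg0 ?addr0//.
  have [] // := ccontinuousM (ccontinuous_circle k.+2%:R) (ccontinuous_horner_circle Q).
move=> t; apply: (@continuous_comp _ _ _ (fun t => k.+1%:R * t + 0)); last exact: cg.
apply: cvgD; last exact: cvg_cst.
by apply: cvgM; [exact: cvg_cst|exact: cvg_id].
Qed.

Lemma sqr_normcD z w : normc (z + w) ^+ 2 =
  normc z ^+ 2 + normc w ^+ 2 + 2 * complex.Re (z^*%C * w).
Proof. by rewrite !normc_sqrE; case: z w => [a b] [c d] /=; ring. Qed.

Lemma continuous_normc_sqrE (Q : {poly R[i]}) :
  continuous (fun t : R => normc Q.[circle_exp t] ^+ 2).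
Proof.
have c := ccontinuous_normc (ccontinuous_horner_circle Q).
have -> : (fun t : R => normc Q.[circle_exp t] ^+ 2) =
  fun t => normc Q.[circle_exp t] * normc Q.[circle_exp t] by [].
by move=> t; apply: cvgM; exact: c.
Qed.

(** Parseval for one coefficient at a time: the cross term 2 Re (conj(c) e(t) Q(e(t))) has mean
    zero. *)
Lemma mean_sqr_normc_MXaddC (Q : {poly R[i]}) c :
  mean (fun t => normc (Q * 'X + c%:P).[circle_exp t] ^+ 2) =
  normc c ^+ 2 + mean (fun t => normc Q.[circle_exp t] ^+ 2).
Proof.
pose h t := complex.Re (circle_exp (1%:R * t) * (c^*%C *: Q).[circle_exp t]).
have ch : continuous h.
  by have [] := ccontinuousM (ccontinuous_circle 1) (ccontinuous_horner_circle (c^*%C *: Q)).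
transitivity (mean (fun t => (normc c ^+ 2 + normc Q.[circle_exp t] ^+ 2) + 2 * h t)).
  apply: mean_ext => t; rewrite hornerMXaddC addrC sqr_normcD normcM normc_circle mulr1.
  by rewrite /h mul1r hornerZ; congr (_ + 2 * complex.Re _); ring.
rewrite meanD.
- rewrite meanZ// mean_Re_circle_horner mulr0 addr0 meanD ?mean_cst//.
    by move=> t; exact: cvg_cst.
  exact: continuous_normc_sqrE.
- by move=> t; apply: cvgD; [exact: cvg_cst|exact: continuous_normc_sqrE].
- by move=> t; apply: cvgM; [exact: cvg_cst|exact: ch].
Qed.

Lemma poly_MXaddC (P : {poly R[i]}) : exists Q c, P = Q * 'X + c%:P.
Proof.
elim/poly_ind: P => [|Q c _]; last by exists Q, c.
by exists 0, 0; rewrite mul0r addr0.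
Qed.

(** Two coefficients are split off and the nonnegative mean of the remaining quotient is dropped. *)
Lemma bessel_coef01 (P : {poly R[i]}) :
  normc P`_0 ^+ 2 + normc P`_1 ^+ 2 <= mean (fun t => normc P.[circle_exp t] ^+ 2).
Proof.
have [Q [c ->]] := poly_MXaddC P; have [S [d ->]] := poly_MXaddC Q.
rewrite !mean_sqr_normc_MXaddC !coefD !coefMX !coefC /= add0r coefD coefMX coefC/=.
rewrite add0r addr0 addrA lerDl; apply: mean_ge0 => t; exact: sqr_ge0.
Qed.

End Bessel.

(** * Truncated logarithm *)

Section Log.
Context {R : realType}.
Implicit Types (p q t x r a b : R) (z w : R[i]).

(* The real part of the m-th Taylor polynomial of log (1 + w) at w = x e^(iu). *)
Definition log1p_cos (u : R) (m : nat) x : R :=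
  \sum_(j < m) ((-1) ^+ j * cos (j.+1%:R * u) / j.+1%:R) * x ^+ j.+1.

(** The geometric expansion of the real part of e^(iu) / (1 + x e^(iu)), cut after m terms. *)
Definition dlog1p_cos (u : R) (m : nat) x : R :=
  \sum_(j < m) cos (j.+1%:R * u) * (- x) ^+ j.

Lemma cos_rec (u : R) (j : nat) :
  2 * cos u * cos (j.+1%:R * u) = cos (j.+2%:R * u) + cos (j%:R * u).
Proof.
have -> : j.+2%:R * u = j.+1%:R * u + u by rewrite -[j.+2%:R]natr1; ring.
have -> : j%:R * u = j.+1%:R * u - u by rewrite -[j.+1%:R]natr1; ring.
by rewrite cosD cosB; ring.
Qed.

(* This is the real part of (1 + x e^(-iu)) e^(iu) (1 - w^m), with w = - x e^(iu), obtained by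
   summing the geometric progression. *)
Lemma dlog1p_cosE (u : R) (m : nat) x :
  (1 + 2 * x * cos u + x ^+ 2) * dlog1p_cos u m x =
  cos u + x - (- x) ^+ m * (cos (m.+1%:R * u) + x * cos (m%:R * u)).
Proof.
rewrite /dlog1p_cos; elim: m => [|m IH].
  by rewrite big_ord0 mulr0 expr0 !mul1r mul0r cos0; ring.
rewrite big_ord_recr /= mulrDr IH (exprS (- x)).
have := cos_rec u m; set c2 := cos (m.+2%:R * u); set c1 := cos (m.+1%:R * u).
set c0 := cos (m%:R * u); set y := (- x) ^+ m => e.
have -> : c2 = 2 * cos u * c1 - c0 by rewrite e; ring.
ring.
Qed.

Lemma is_derive_log1p_cos (u : R) (m : nat) x :
  is_derive x 1 (log1p_cos u m) (dlog1p_cos u m x).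
Proof.
elim: m => [|m IH].
  have -> : log1p_cos u 0 = cst 0 by apply/funext => y; rewrite /log1p_cos big_ord0.
  by rewrite /dlog1p_cos big_ord0; exact: is_derive_cst.
have -> : log1p_cos u m.+1 = fun y => log1p_cos u m y +
    ((-1) ^+ m * cos (m.+1%:R * u) / m.+1%:R) * y ^+ m.+1.
  by apply/funext => y; rewrite /log1p_cos big_ord_recr.
rewrite /dlog1p_cos big_ord_recr /=.
apply: is_deriveD; set k := (-1) ^+ m * _ / _.
have -> : (fun y => k * y ^+ m.+1) = k \*: (id ^+ m.+1).
  by apply/funext => y; rewrite !fctE.
have := is_deriveZ k (is_deriveX m.+1 (is_derive_id x 1)).
move/is_derive_eq; apply; rewrite {}/k.
rewrite /= [(- x) ^+ m]exprNn /GRing.scale /=.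
have : m.+1%:R != 0 :> R by [].
by move: (m.+1%:R) (cos _) => k c k0; field.
Qed.

(** With W(x) = |1 + x e^(iu)|^2, the difference between the Taylor polynomial and (ln W)/2 vanishes
    at 0. Its derivative is the tail of a geometric progression, and the mean value theorem
    concludes. *)
Lemma log1p_cos_le (u : R) (m : nat) r : 0 <= r -> r < 1 ->
  log1p_cos u m r <= ln (1 + 2 * r * cos u + r ^+ 2) / 2 + 2 * r ^+ m / (1 - r) ^+ 2.
Proof.
move=> r0 r1; set c := cos u.
have c1 : -1 <= c by exact: cos_geN1.
have c2 : c <= 1 by exact: cos_le1.
pose W x := 1 + 2 * x * c + x ^+ 2.
have Wge x : 0 <= x -> x <= r -> (1 - r) ^+ 2 <= W x.
  move=> x0 xr; apply: (@le_trans _ _ ((1 - x) ^+ 2)).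
    by rewrite lerXn2r ?nnegrE; lra.
  have : 0 <= x * (1 + c) by rewrite mulr_ge0//; lra.
  by rewrite /W !expr2; lra.
have W0 x : 0 <= x -> x <= r -> 0 < W x.
  by move=> x0 xr; apply: lt_le_trans (Wge x x0 xr); rewrite exprn_gt0//; lra.
pose h x := log1p_cos u m x - 2^-1 * ln (W x).
pose dh x := dlog1p_cos u m x - 2^-1 * ((W x)^-1 * (2 * c + 2 * x)).
have dW x : is_derive x 1 W (2 * c + 2 * x).
  have := is_deriveD (is_deriveD (is_derive_cst (1 : R) x 1)
    (is_deriveZ (2 * c) (is_derive_id x 1)))
     (is_deriveX 2 (is_derive_id x 1)).
  have -> : (cst 1 + (2 * c) \*: id + id ^+ 2)%R = W.
    apply/funext => y; rewrite !fctE.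
    by transitivity (1 + 2 * c * y + y ^+ 2); rewrite // /W; ring.
  move/is_derive_eq; apply.
  by transitivity (0 + 2 * c * 1 + 2 * x ^+ 1 * 1); [|ring].
have dhx x : 0 <= x -> x <= r -> is_derive x 1 h (dh x).
  move=> x0 xr.
  have dl : is_derive (W x) 1 (@ln R) (W x)^-1 by apply: is_derive1_ln; exact: W0.
  exact: (is_deriveB (is_derive_log1p_cos u m x)
    (is_deriveZ 2^-1 (@is_derive1_comp R (@ln R) W x _ _ dl (dW x)))).
have [||y] := @MVT_segment R h dh 0 r r0.
- by move=> x; rewrite in_itv/= => /andP[x0 xr]; apply: dhx; exact: ltW.
- apply: continuous_in_subspaceT => x /[!inE]/=; rewrite in_itv/= => /andP[x0 xr].
  apply: differentiable_continuous; apply/derivable1_diffP.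
  by case: (dhx x x0 xr).
rewrite in_itv/= => /andP[y0 yr].
have h0 : h 0 = 0.
  rewrite /h /W mulr0 mul0r expr0n /= !addr0 ln1 mulr0 subr0 /log1p_cos.
  by rewrite big1// => j _; rewrite expr0n mulr0.
rewrite h0 !subr0 => hr.
(* The tail has numerator at most r^m (1 + y) <= 2 r^m in modulus, over W(y) >= (1 - r)^2. *)
have dhy : dh y <= 2 * r ^+ m / (1 - r) ^+ 2.
  have Wy := W0 y y0 yr.
  have -> : dh y = - ((- y) ^+ m * (cos (m.+1%:R * u) + y * cos (m%:R * u))) / W y.
    have := dlog1p_cosE u m y; rewrite -/c -/(W y) => e.
    have -> : dh y = (W y * dlog1p_cos u m y - (c + y)) / W y.
      by rewrite /dh; field; rewrite gt_eqF.
    by rewrite e; congr (_ / _); ring.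
  apply: (@le_trans _ _ (2 * r ^+ m / W y)); last first.
    apply: ler_pM => //; rewrite ?invr_ge0 ?(ltW Wy) ?mulr_ge0 ?exprn_ge0//.
    by rewrite lef_pV2 ?posrE ?Wge// exprn_gt0//; lra.
  rewrite ler_pM2r ?invr_gt0//; apply: le_trans (ler_norm _) _.
  rewrite normrN normrM normrX normrN mulrC; apply: ler_pM => //.
    rewrite (le_trans (ler_normD _ _))// normrM (ger0_norm y0).
    have n1 := cos_max (m.+1%:R * u); have n2 := cos_max (m%:R * u).
    have := normr_ge0 (cos (m%:R * u)); nra.
  by rewrite ger0_norm// lerXn2r ?nnegrE.
have : dh y * r <= 2 * r ^+ m / (1 - r) ^+ 2.
  apply: le_trans (ler_wpM2r r0 dhy) _; rewrite ler_piMr ?(ltW r1)//.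
  by rewrite divr_ge0 ?mulr_ge0 ?exprn_ge0//; lra.
rewrite -hr /h -/(W r); lra.
Qed.

(* The constant coefficient vanishes because 0^-1 = 0. *)
Definition log1p_poly r (m : nat) : {poly R[i]} :=
  \poly_(j < m.+1) ((- (- r) ^+ j / j%:R)%:C)%C.

Lemma log1p_poly_coef0 r m : (log1p_poly r m)`_0 = 0.
Proof. by rewrite coef_poly /= invr0 mulr0. Qed.

Lemma log1p_poly_coef1 r m : (log1p_poly r m.+1)`_1 = r%:C%C.
Proof. by rewrite coef_poly /= expr1 opprK divr1. Qed.

Lemma log1p_polyE r m t : (log1p_poly r m).[circle_exp t] =
  \sum_(j < m) ((- (- r) ^+ j.+1 / j.+1%:R)%:C)%C * circle_exp (j.+1%:R * t).
Proof.
rewrite horner_poly big_ord_recl /= invr0 mulr0 mul0r add0r.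
by apply: eq_bigr => j _; rewrite circle_expX.
Qed.

Lemma Re_log1p_poly r m t :
  complex.Re (log1p_poly r m).[circle_exp t] = log1p_cos (2 * pi * t) m r.
Proof.
rewrite log1p_polyE /log1p_cos raddf_sum; apply: eq_bigr => j _ /=.
rewrite mul0r subr0 (exprNn r) (exprS (-1)).
have -> : 2 * pi * (j.+1%:R * t) = j.+1%:R * (2 * pi * t) by ring.
ring.
Qed.

(** Termwise r^(j+1)/(j+1) <= r^j, and the geometric sum is at most 1/(1 - r). *)
Lemma normc_log1p_poly r m t : 0 <= r -> r < 1 ->
  normc (log1p_poly r m).[circle_exp t] <= (1 - r)^-1.
Proof.
move=> r0 r1; rewrite log1p_polyE; apply: le_trans (normc_sum _) _.
apply: (@le_trans _ _ (\sum_(j < m) r ^+ j)).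
  apply: ler_sum => j _; rewrite normcM normc_circle mulr1 normc_real.
  rewrite normrM normrN normrX normrN (ger0_norm r0) ger0_norm ?invr_ge0//.
  rewrite exprSr -mulrA ler_piMr ?exprn_ge0// ler_pdivrMr ?ltr0n// mul1r.
  by rewrite (le_trans (ltW r1))// ler1n.
have : (1 - r) * \sum_(j < m) r ^+ j <= 1.
  rewrite -opprB mulNr -subrX1 opprB; have := exprn_ge0 m r0; lra.
by rewrite -ler_pdivlMl ?mulr1//; lra.
Qed.

End Log.

(** * Polynomial approximation of (1 + r z)^q *)

Section Truncation.
Context {R : realType}.
Implicit Types (p q t x r a b : R) (z w : R[i]).

(** The left side expands to 1 + 2k Re z + k^2 |z|^2, and 1 + x <= exp x. *)
Lemma sqr_normc_exp_le z (k : R) :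
  normc (1 + k%:C%C * z) ^+ 2 <= expR (2 * k * complex.Re z + k ^+ 2 * normc z ^+ 2).
Proof.
apply: le_trans (expR_ge1Dx _).
by rewrite !normc_sqrE; case: z => a b /=; nra.
Qed.

(** The first term is 2q times the Taylor remainder of the logarithm; the second bounds n times the
    quadratic term (q/n)^2 |l_n|^2. *)
Definition trunc_err q r (n : nat) : R :=
  q * (4 * r ^+ n / (1 - r) ^+ 2) + q ^+ 2 * (1 - r) ^- 2 * n%:R^-1.

(** One n serves both as truncation degree and as exponent, so a single limit removes both
    errors. *)
Definition pow1p_poly q r (n : nat) : {poly R[i]} :=
  (1 + (q / n%:R)%:C%C *: log1p_poly r n) ^+ n.

Lemma pow1p_poly_coef0 q r n : (pow1p_poly q r n)`_0 = 1.
Proof.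
rewrite -horner_coef0 horner_exp hornerD hornerC hornerZ horner_coef0.
by rewrite log1p_poly_coef0 mulr0 addr0 expr1n.
Qed.

(** The derivative at 0: the base equals 1 there, which leaves (n+1) times (q/(n+1)) r. *)
Lemma pow1p_poly_coef1 q r n : (pow1p_poly q r n.+1)`_1 = (q * r)%:C%C.
Proof.
have -> : (pow1p_poly q r n.+1)`_1 = (pow1p_poly q r n.+1)^`()`_0.
  by rewrite coef_deriv.
rewrite deriv_exp -horner_coef0 hornerMn hornerM horner_exp /=.
rewrite derivD derivC add0r derivZ hornerD hornerC !hornerZ !horner_coef0.
rewrite coef_deriv log1p_poly_coef0 log1p_poly_coef1 mulr0 addr0 expr1n mulr1.
rewrite -rmorphM -rmorphMn /=; congr (_%:C)%C.
have : n.+1%:R != 0 :> R by [].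
by rewrite -[X in _ -> X = _]mulr_natl; move: n.+1%:R => k k0; field.
Qed.

Lemma sqr_normc_pow1p_poly q r (n : nat) t : 0 < q -> 0 <= r -> r < 1 ->
  normc (pow1p_poly q r n.+1).[circle_exp t] ^+ 2 <=
  expR (trunc_err q r n.+1) * normc (1%:C%C + r%:C%C * circle_exp t) `^ (2 * q).
Proof.
move=> q0 r0 r1; set u := (log1p_poly r n.+1).[circle_exp t].
have n0 : 0 < n.+1%:R :> R by [].
rewrite horner_exp hornerD hornerC hornerZ -/u normcX exprAC.
apply: (@le_trans _ _ (expR (2 * (q / n.+1%:R) * complex.Re u +
    (q / n.+1%:R) ^+ 2 * normc u ^+ 2) ^+ n.+1)).
  by rewrite lerXn2r ?nnegrE ?expR_ge0 ?sqr_ge0// sqr_normc_exp_le.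
rewrite -expRM_natl powR_normc (_ : 2 * q / 2 = q); last by lra.
rewrite sqr_normc_binomial.
set W := 1 ^+ 2 + _ + _.
have WE : W = 1 + 2 * r * cos (2 * pi * t) + r ^+ 2 by rewrite /W; ring.
have W0 : 0 < W.
  have c1 := cos_geN1 (2 * pi * t).
  have h1 : 0 < (1 - r) ^+ 2 by rewrite exprn_gt0//; lra.
  have h2 : 0 <= r * (1 + cos (2 * pi * t)) by rewrite mulr_ge0//; lra.
  by rewrite WE; move: h1; rewrite !expr2; lra.
(* As W > 0, its power is exp (q ln W), and it remains to compare exponents. *)
rewrite /powR gt_eqF// -expRD ler_expR.
have h1 := log1p_cos_le (2 * pi * t) n.+1 r0 r1.
rewrite -Re_log1p_poly -/u -WE in h1.
have h2 : normc u ^+ 2 <= (1 - r) ^- 2.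
  by rewrite -exprVn lerXn2r ?nnegrE ?normc_ge0 ?normc_log1p_poly// invr_ge0; lra.
have -> : n.+1%:R * (2 * (q / n.+1%:R) * complex.Re u + (q / n.+1%:R) ^+ 2 * normc u ^+ 2)
  = 2 * q * complex.Re u + q ^+ 2 * normc u ^+ 2 * n.+1%:R^-1.
  have : n.+1%:R != 0 :> R by [].
  by move: n.+1%:R => k k0; field.
have h3 : q ^+ 2 * normc u ^+ 2 * n.+1%:R^-1 <= q ^+ 2 * (1 - r) ^- 2 * n.+1%:R^-1.
  by rewrite ler_wpM2r ?invr_ge0 ?(ltW n0)// ler_wpM2l ?sqr_ge0.
have h4 := ler_wpM2l (ltW q0) h1.
rewrite /trunc_err (_ : q * (4 * r ^+ n.+1 / (1 - r) ^+ 2) =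
  2 * (q * (2 * r ^+ n.+1 / (1 - r) ^+ 2))); last by ring.
move: h3 h4; rewrite mulrDr.
move: (_ * n.+1%:R^-1) (q ^+ 2 * _ * n.+1%:R^-1) (q * (2 * _ / _)) => X Y Z h3 h4.
lra.
Qed.

Lemma trunc_err_cvg q r : 0 <= r -> r < 1 -> trunc_err q r n.+1 @[n --> \oo] --> 0.
Proof.
move=> r0 r1.
have h1 : r ^+ n.+1 @[n --> \oo] --> 0.
  have := @cvg_expr R r; rewrite ger0_norm// => /(_ r1).
  by rewrite -(cvg_shiftS (GRing.exp r)).
have h2 : n.+1%:R^-1 @[n --> \oo] --> (0 : R) by exact: cvg_harmonic.
have -> : 0 = q * (4 * 0 / (1 - r) ^+ 2) + q ^+ 2 * (1 - r) ^- 2 * 0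
  by rewrite !(mulr0, mul0r) addr0.
apply: cvgD; last by apply: cvgM; [exact: cvg_cst|].
apply: cvgM; first exact: cvg_cst.
apply: cvgM; last exact: cvg_cst.
by apply: cvgM; [exact: cvg_cst|].
Qed.

(** Bessel gives the bound up to the factor exp ([trunc_err]) for every n, and this factor tends to
    1. *)
Lemma binomial_mean_ge_lt1 p r : 0 < p -> 0 <= r -> r < 1 ->
  1 + (p / 2 * r) ^+ 2 <= binomial_mean p 1 r.
Proof.
move=> p0 r0 r1; set q := p / 2.
have q0 : 0 < q by rewrite divr_gt0.
have bound (n : nat) : 1 + (q * r) ^+ 2 <= expR (trunc_err q r n.+1) * binomial_mean p 1 r.
  have := bessel_coef01 (pow1p_poly q r n.+1).
  rewrite pow1p_poly_coef0 pow1p_poly_coef1 normc1 normc_real real_normK ?num_real// expr1n.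
  move=> /le_trans; apply.
  rewrite -meanZ; last exact: continuous_binomial_powR.
  apply: le_mean; first exact: continuous_normc_sqrE.
    by move=> t; apply: cvgM; [exact: cvg_cst|exact: continuous_binomial_powR].
  move=> t; have := sqr_normc_pow1p_poly n t q0 r0 r1.
  by rewrite (_ : 2 * q = p)// /q mulrC divfK.
have lim : expR (trunc_err q r n.+1) * binomial_mean p 1 r @[n --> \oo] -->
    binomial_mean p 1 r.
  rewrite -[X in _ --> X]mul1r -expR0; apply: cvgM; last exact: cvg_cst.
  by apply: continuous_cvg; [exact: continuous_expR|exact: trunc_err_cvg].
rewrite -(cvg_lim _ lim)//; apply: limr_ge; first by apply/cvg_ex; eexists; exact: lim.
exact: nearW.
Qed.

(** For r = 1 and 0 < s < 1, write 1 + s z = s (1 + z) + (1 - s). Convexity and the case s < 1 give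
    1 + q^2 s^2 <= s B + 1 - s, hence 1 + q^2 s <= B, and s can be taken close to 1. *)
Lemma binomial_mean_ge p r : 1 <= p -> 0 <= r -> r <= 1 ->
  1 + (p / 2 * r) ^+ 2 <= binomial_mean p 1 r.
Proof.
move=> p1 r0; have p0 : 0 < p by rewrite (lt_le_trans ltr01).
rewrite le_eqVlt => /predU1P[->|r1]; last exact: binomial_mean_ge_lt1.
set q := p / 2; set B := binomial_mean p 1 1.
have cB := @continuous_binomial_powR R p 1 1 p0.
have q2 : 0 < q ^+ 2 by rewrite exprn_gt0// divr_gt0.
have conv s : 0 < s -> s < 1 -> 1 + q ^+ 2 * s <= B.
  move=> s0 s1.
  have := binomial_mean_ge_lt1 p0 (ltW s0) s1; rewrite -/q => h.
  have : binomial_mean p 1 s <= s * B + (1 - s).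
    have -> : s * B + (1 - s) = mean (fun t =>
        s * normc (1%:C%C + 1%:C%C * circle_exp t) `^ p + (1 - s)).
      rewrite meanD ?meanZ ?mean_cst//.
        by move=> t; apply: cvgM; [exact: cvg_cst|exact: cB].
      by move=> t; exact: cvg_cst.
    apply: le_mean; first exact: continuous_binomial_powR.
      move=> t; apply: cvgD; last exact: cvg_cst.
      by apply: cvgM; [exact: cvg_cst|exact: cB].
    move=> t; set y := normc (1%:C%C + 1%:C%C * circle_exp t).
    have y0 : 0 <= y by exact: normc_ge0.
    have s01 : 0 <= s <= 1 by rewrite !ltW.
    have := convex_powR2 p1 y0 ler01 s01; rewrite powR1 !mulr1.
    apply: le_trans; apply: ge0_ler_powR; rewrite ?nnegrE ?normc_ge0 ?(ltW p0)//.
      by rewrite addr_ge0 ?mulr_ge0 ?(ltW s0)//; lra.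
    have -> : 1%:C%C + s%:C%C * circle_exp t =
        s%:C%C * (1%:C%C + 1%:C%C * circle_exp t) + (1 - s)%:C%C.
      by rewrite rmorphB /=; ring.
    rewrite (le_trans (le_normcD _ _))// normcM !normc_real !ger0_norm ?(ltW s0)//.
    lra.
  move=> /(le_trans h); rewrite exprMn => h'.
  rewrite -(ler_pM2l s0); nra.
rewrite mulr1 leNgt; apply/negP => BL.
have B1 : 1 + q ^+ 2 * 2^-1 <= B by apply: conv; lra.
(* Here q^2 e is half of the supposed deficit, so s = 1 - e already contradicts it; [B1], the case s
   = 1/2, ensures e < 1. *)
pose e := (1 + q ^+ 2 - B) / (2 * q ^+ 2).
have eE : q ^+ 2 * e = (1 + q ^+ 2 - B) / 2 by rewrite /e; field; rewrite gt_eqF// divr_gt0.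
have e0 : 0 < e by rewrite divr_gt0 ?mulr_gt0//; lra.
have e1 : e < 1 by rewrite -(ltr_pM2l q2) eE; lra.
have : 1 + q ^+ 2 * (1 - e) <= B by apply: conv; lra.
rewrite mulrBr eE; lra.
Qed.

End Truncation.

(** * Lower bounds for the norms of F *)

Theorem theorem2 (R : realType) (N : nat) (F : {poly R[i]})
  (hN : (1 <= N)%N) (hF : size F = N.+1)
  (L M : nat) (hLM : (L < M)%N) (hMN : (M <= N)%N)
  (hgap : (maxn L (N - M) < M - L)%N) :
  [/\ normc F`_L + normc F`_M <= poly_supnorm F,
      (forall p : R, 1 <= p -> p <= 2 ->
        Bconst p * (normc F`_L `^ p + normc F`_M `^ p) `^ p^-1
          <= poly_pnorm p F)
    & (forall p : R, 1 <= p -> ~ (F`_L = 0 /\ F`_M = 0) ->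
        Num.max (normc F`_L) (normc F`_M)
          * (1 + (p * Num.min (normc F`_L) (normc F`_M)
                    / (2 * Num.max (normc F`_L) (normc F`_M))) ^+ 2) `^ p^-1
          <= poly_pnorm p F)].
Proof.
have sF : (size F <= N.+1)%N by rewrite hF.
have pnorm_ge (p : R) : 1 <= p ->
    binomial_mean p (normc F`_L) (normc F`_M) `^ p^-1 <= poly_pnorm p F.
  move=> p1; have p0 : 0 < p by rewrite (lt_le_trans ltr01).
  apply: ge0_ler_powR; rewrite ?nnegrE ?invr_ge0 ?(ltW p0)//.
  - by apply: mean_ge0 => t; exact: powR_ge0.
  - by apply: Rintegral_ge0 => t _; exact: powR_ge0.
  - exact: binomial_mean_le sF hLM hMN hgap.
split; first exact: supnorm_lower_bound sF hLM hMN hgap.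
- move=> p p1 p2; have p0 : 0 < p by rewrite (lt_le_trans ltr01).
  apply: le_trans (pnorm_ge p p1).
  have -> : Bconst p = (2^-1 * binomial_mean p 1 (-1)) `^ p^-1.
    have <- : mean (fun t => normc (1 - circle_exp t) `^ p) = binomial_mean p 1 (-1).
      by apply: mean_ext => t; rewrite rmorphN mulNr mul1r.
    by [].
  have B0 (x y : R) : 0 <= binomial_mean p x y by apply: mean_ge0 => t; exact: powR_ge0.
  rewrite -powRM ?mulr_ge0 ?addr_ge0 ?powR_ge0//.
  apply: ge0_ler_powR; rewrite ?nnegrE ?invr_ge0 ?(ltW p0) ?mulr_ge0 ?addr_ge0 ?powR_ge0//.
  by apply: binomial_mean_lower; rewrite ?normc_ge0.
move=> p p1 LM0; have p0 : 0 < p by rewrite (lt_le_trans ltr01).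
apply: le_trans (pnorm_ge p p1).
(* By homogeneity the larger modulus x factors out, leaving the ratio r = y/x in [0, 1]. *)
have key (x y : R) : 0 < x -> 0 <= y -> y <= x ->
    x * (1 + (p * y / (2 * x)) ^+ 2) `^ p^-1 <= binomial_mean p x y `^ p^-1.
  move=> x0 y0 yx.
  have -> : binomial_mean p x y = x `^ p * binomial_mean p 1 (y / x).
    have := binomial_meanZ 1 (y / x) p0 (ltW x0).
    by rewrite mulr1 (mulrC x) divfK ?gt_eqF// => ->.
  have r0 : 0 <= y / x by rewrite divr_ge0 ?(ltW x0).
  rewrite powRM ?powR_ge0//; last by apply: mean_ge0 => t; exact: powR_ge0.
  rewrite -powRrM mulfV ?gt_eqF// powRr1 ?(ltW x0)// ler_wpM2l ?(ltW x0)//.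
  have -> : p * y / (2 * x) = p / 2 * (y / x) by field; rewrite gt_eqF.
  apply: ge0_ler_powR; rewrite ?nnegrE ?invr_ge0 ?(ltW p0) ?addr_ge0 ?sqr_ge0//.
    by apply: mean_ge0 => t; exact: powR_ge0.
  by apply: binomial_mean_ge => //; rewrite ler_pdivrMr ?mul1r.
have n0 z : normc z <= 0 :> R -> z = 0.
  by move=> zn; apply: eq0_normc; apply/le_anti; rewrite zn normc_ge0.
(* Symmetry of the binomial mean puts the larger modulus first; it is positive, since otherwise both
   coefficients would vanish. *)
have [LM|ML] := leP (normc F`_L) (normc F`_M).
  rewrite binomial_meanC; apply: key; rewrite ?normc_ge0// ltNge; apply/negP => M0.
  by apply: LM0; split; apply: n0 => //; exact: le_trans LM M0.
by apply: key; rewrite ?normc_ge0 ?(ltW ML)// (le_lt_trans _ ML) ?normc_ge0.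
Qed.
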